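(* Let $\mathring a$ be the manifestation set $[\![A]\!]$ of the formula $A(y,z)\equiv y\notin z$, i.e. $\mathring a=\{v\mid\langle v,\mathbf a\rangle\in\mathbf a\}$ with $\mathbf a=\{\langle y,z\rangle\mid y\notin\{w\mid\langle w,z\rangle\in z\}\}$. Then $\Vdash\forall v(v\in\mathring a)$ and $\Vdash\forall v(v\notin\mathring a)$.
   Context: The language of the librationist theory £: variables; primitive set constants $\mathcal T$ (truth set) and $\mathcal F$; atomic formulas $a\in b$; formulas $\downarrow AB$ (joint denial), $\forall vA$; terms $\{v\mid A\}$; name terms $\ulcorner X\urcorner$. $\neg A:=\downarrow AA$, $a\notin b:=\neg a\in b$, other connectives and $\exists$ classical; $\mathcal TA$ abbreviates $\ulcorner A\urcorner\in\mathcal T$. Identity: $a=b:\equiv\forall u(a\in u\to b\in u)$; $\{a,b\}\equiv\{x\mid x=a\vee x=b\}$, $\{a\}\equiv\{a,a\}$, $\langle a,b\rangle\equiv\{\{a\},\{a,b\}\}$, $\{\langle y,z\rangle\mid B\}\equiv\{u\mid\exists y\exists z(u=\langle y,z\rangle\wedge B)\}$. Semantics: for each $n\in\omega$ and ordinal $\alpha$ a full set $\models^\alpha_n$ of formulas ($\downarrow AB$ in it iff neither $A$ nor $B$; $\forall vA$ in it iff all substitution instances $A^b_v$ are); $(\models^0_n)_n$ a fixed enumeration of full sets; for $\alpha>0$, $\mathcal TA\in\models^\alpha_n$ iff for some $\gamma<\alpha$, $A\in\models^\delta_n$ for all $\gamma\le\delta<\alpha$, and $a\in\{x\mid A\}\in\models^\alpha_n$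 iff $\mathcal TA^a_x\in\models^\alpha_n$. $\models^\alpha B$ iff $B\in\models^\alpha_n$ for all $n$. $\mathrm{IN}^\alpha(A)$ iff $\models^\beta\mathcal TA$ for all $\beta\ge\alpha$; $\mathrm{IN}(A)$ iff $\exists\alpha\,\mathrm{IN}^\alpha(A)$; $\alpha$ stabilizes $A$ iff ($\mathrm{IN}(A)\Rightarrow\mathrm{IN}^\alpha(A)$) and ($\models^\alpha\mathcal TA\Rightarrow\mathrm{IN}(A)$); $\varpi$ is the least ordinal stabilizing every sentence. $\Vdash A$ ($A$ is a thesis) iff $\neg\mathcal T\neg A\in\models^\varpi_n$ for all $n$.
   Formalization: The formal statement adds the hypothesis that ϖ > 0, i.e. that stage 0 does not already stabilize every sentence; if the starting full sets are chosen so that ϖ = 0, the truth clause does not apply at ϖ and the claim can fail. *)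

(* Defs.v *)
(** * Syntax

    Expressions in de Bruijn notation: [TAbs A] (the term {v | A}) and
    [FAll A] bind the index 0 of [A].  Every expression has a name; names are
    transparent, i.e. the free variables of [X] are free in its name and
    substitution acts inside, so that (T A)^b_v is T (A^b_v). *)

Inductive term : Type :=
  | TVar (i : nat)
  | TTruth
  | TF
  | TAbs (A : formula)
  | TNameF (A : formula)
  | TNameT (a : term)
with formula : Type :=
  | FMem (a b : term)
  | FNor (A B : formula)
  | FAll (A : formula).

Definition up_ren (r : nat -> nat) (i : nat) : nat :=
  match i with 0 => 0 | S j => S (r j) end.

Fixpoint ren_term (r : nat -> nat) (t : term) : term :=
  match t with
  | TVar i => TVar (r i)
  | TTruth => TTruth
  | TF => TF
  | TAbs A => TAbs (ren_formula (up_ren r) A)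
  | TNameF A => TNameF (ren_formula r A)
  | TNameT a => TNameT (ren_term r a)
  end
with ren_formula (r : nat -> nat) (A : formula) : formula :=
  match A with
  | FMem a b => FMem (ren_term r a) (ren_term r b)
  | FNor A B => FNor (ren_formula r A) (ren_formula r B)
  | FAll A => FAll (ren_formula (up_ren r) A)
  end.

Definition shift (t : term) : term := ren_term S t.

Definition up (s : nat -> term) (i : nat) : term :=
  match i with 0 => TVar 0 | S j => shift (s j) end.

Fixpoint subst_term (s : nat -> term) (t : term) : term :=
  match t with
  | TVar i => s i
  | TTruth => TTruth
  | TF => TF
  | TAbs A => TAbs (subst_formula (up s) A)
  | TNameF A => TNameF (subst_formula s A)
  | TNameT a => TNameT (subst_term s a)
  end
with subst_formula (s : nat -> term) (A : formula) : formula :=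
  match A with
  | FMem a b => FMem (subst_term s a) (subst_term s b)
  | FNor A B => FNor (subst_formula s A) (subst_formula s B)
  | FAll A => FAll (subst_formula (up s) A)
  end.

(** A^b_v, where v is the variable of index 0 of [A]; the binder of v is
    removed, so the other indices go down by one. *)
Definition inst (A : formula) (b : term) : formula :=
  subst_formula (fun i => match i with 0 => b | S j => TVar j end) A.

Fixpoint term_below (n : nat) (t : term) : Prop :=
  match t with
  | TVar i => i < n
  | TTruth => True
  | TF => True
  | TAbs A => formula_below (S n) A
  | TNameF A => formula_below n A
  | TNameT a => term_below n a
  end
with formula_below (n : nat) (A : formula) : Prop :=
  match A with
  | FMem a b => term_below n a /\ term_below n b
  | FNor A B => formula_below n A /\ formula_below n B
  | FAll A => formula_below (S n) A
  end.

Definition sentence (A : formula) : Prop := formula_below 0 A.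

Definition FNeg (A : formula) : formula := FNor A A.
Definition FOr (A B : formula) : formula := FNeg (FNor A B).
Definition FAnd (A B : formula) : formula := FNor (FNeg A) (FNeg B).
Definition FImp (A B : formula) : formula := FOr (FNeg A) B.
Definition FEx (A : formula) : formula := FNeg (FAll (FNeg A)).
Definition FNotMem (a b : term) : formula := FNeg (FMem a b).

Definition FTrue (A : formula) : formula := FMem (TNameF A) TTruth.

Definition FEq (a b : term) : formula :=
  FAll (FImp (FMem (shift a) (TVar 0)) (FMem (shift b) (TVar 0))).

Definition TPair (a b : term) : term :=
  TAbs (FOr (FEq (TVar 0) (shift a)) (FEq (TVar 0) (shift b))).
Definition TSing (a : term) : term := TPair a a.
Definition TOPair (a b : term) : term := TPair (TSing a) (TPair a b).

(** {<y,z> | B}, where in [B] the variable y has index 1 and z index 0.  The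
    parameters of [B], of index at least 2, skip the new bound variable u. *)
Definition TRel (B : formula) : term :=
  TAbs (FEx (FEx (FAnd
    (FEq (TVar 2) (TOPair (TVar 1) (TVar 0)))
    (ren_formula
       (fun i => match i with 0 => 0 | 1 => 1 | S (S j) => S (S (S j)) end)
       B)))).

(** For A(y,z), with y of index 1 and z of index 0, [manifestation_kernel A]
    is {<y,z> | A(y, {w | <w,z> \in z})}, and [manifestation A] is
    {v | <v,a> \in a} for that kernel a. *)
Definition manifestation_kernel (A : formula) : term :=
  TRel (subst_formula
    (fun i => match i with
              | 0 => TAbs (FMem (TOPair (TVar 0) (TVar 1)) (TVar 1))
              | S j => TVar (S j)
              end) A).

Definition manifestation (A : formula) : term :=
  let a := shift (manifestation_kernel A) in
  TAbs (FMem (TOPair (TVar 0) a) a).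

Definition ring_a : term := manifestation (FNotMem (TVar 1) (TVar 0)).

Lemma manifestation_kernel_notmemE :
  manifestation_kernel (FNotMem (TVar 1) (TVar 0)) =
  TAbs (FEx (FEx (FAnd
    (FEq (TVar 2) (TOPair (TVar 1) (TVar 0)))
    (FNotMem (TVar 1) (TAbs (FMem (TOPair (TVar 0) (TVar 1)) (TVar 1))))))).
Proof. reflexivity. Qed.

Lemma ring_aE :
  ring_a =
  TAbs (FMem (TOPair (TVar 0) (manifestation_kernel (FNotMem (TVar 1) (TVar 0))))
             (manifestation_kernel (FNotMem (TVar 1) (TVar 0)))).
Proof. reflexivity. Qed.

(** * Ordinals

    [osup f] is the least ordinal strictly above all the [f i].  Distinct
    terms may denote the same ordinal; [oeq] is equality of ordinals. *)

Inductive ord : Type := osup (I : Type) (f : I -> ord).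

Fixpoint ole (x y : ord) : Prop :=
  match x, y with
  | osup _ f, osup _ g => forall i, exists j, ole (f i) (g j)
  end.

Definition olt (x y : ord) : Prop :=
  match y with osup _ g => exists j, ole x (g j) end.

Definition oeq (x y : ord) : Prop := ole x y /\ ole y x.

Definition ozero : ord := osup Empty_set (fun e => match e with end).

(** * Semantics *)

(** Quantifiers are substitutional, over all terms [b]. *)
Definition full (M : formula -> Prop) : Prop :=
  (forall A B, M (FNor A B) <-> ~ M A /\ ~ M B) /\
  (forall A, M (FAll A) <-> forall b, M (inst A b)).

(** [M alpha n] is the set |=^alpha_n.  The starting sequence [M ozero] is an
    arbitrary sequence of full sets, and atoms not covered by the two clauses
    for positive ordinals (such as membership in [TF], in a name, or of a
    non-name in [TTruth]) are unconstrained. *)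
Record librationist_semantics (M : ord -> nat -> formula -> Prop) : Prop := {
  sem_oeq : forall alpha beta n A,
    oeq alpha beta -> M alpha n A -> M beta n A;
  sem_full : forall alpha n, full (M alpha n);
  sem_truth : forall alpha n A, olt ozero alpha ->
    (M alpha n (FTrue A) <->
     exists gamma, olt gamma alpha /\
       forall delta, ole gamma delta -> olt delta alpha -> M delta n A);
  sem_abs : forall alpha n a A, olt ozero alpha ->
    (M alpha n (FMem a (TAbs A)) <-> M alpha n (FTrue (inst A a)))
}.

Definition models (M : ord -> nat -> formula -> Prop) (alpha : ord)
    (B : formula) : Prop :=
  forall n, M alpha n B.

Definition IN_at (M : ord -> nat -> formula -> Prop) (alpha : ord)
    (A : formula) : Prop :=
  forall beta, ole alpha beta -> models M beta (FTrue A).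

Definition IN (M : ord -> nat -> formula -> Prop) (A : formula) : Prop :=
  exists alpha, IN_at M alpha A.

Definition stabilizes (M : ord -> nat -> formula -> Prop) (alpha : ord)
    (A : formula) : Prop :=
  (IN M A -> IN_at M alpha A) /\ (models M alpha (FTrue A) -> IN M A).

Definition stabilizes_all (M : ord -> nat -> formula -> Prop) (alpha : ord) :
    Prop :=
  forall A, sentence A -> stabilizes M alpha A.

Definition closure_ordinal (M : ord -> nat -> formula -> Prop) (varpi : ord) :
    Prop :=
  stabilizes_all M varpi /\
  forall alpha, stabilizes_all M alpha -> ole varpi alpha.

Definition thesis (M : ord -> nat -> formula -> Prop) (varpi : ord)
    (A : formula) : Prop :=
  forall n, M varpi n (FNeg (FTrue (FNeg A))).

(* Main.v *)
(** Leibniz identity at a stage [alpha > 0] passes to all earlier stages, so for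
    each index and each pair of terms it either always holds or fails from some
    stage on.  Beyond the supremum [kappa] of these stages, identity is a
    permanent congruence, ordered pairs are injective, and <v,a> belongs to the
    kernel a at the next stage iff v is not in the manifestation set: membership
    is complemented every two stages.  At limits and at successors of limits the
    manifestation set is therefore empty, so from the first limit after [kappa]
    on it is alternately everything and nothing, two stages at a time.

    This pattern is expressed by a sentence, [oscillation], which is thus stably
    true, and hence holds eventually below [varpi] for every index.  Since the
    stage before a stabilizing successor stabilizes too, [varpi] is a limit, so
    both phases are cofinal below it. *)

From Stdlib Require Import Classical ClassicalEpsilon Lia.
Require Import Defs.

(** * Substitution *)

Scheme term_mut := Induction for term Sort Prop
  with formula_mut := Induction for formula Sort Prop.
Combined Scheme term_formula_ind from term_mut, formula_mut.

(** The composite is a separate function [q] with a pointwise hypothesis, so the induction passes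
    under binders without functional extensionality. The next lemmas follow the same pattern. *)
Lemma ren_ren_expr :
  (forall t r r' q, (forall i, r' (r i) = q i) ->
     ren_term r' (ren_term r t) = ren_term q t) /\
  (forall A r r' q, (forall i, r' (r i) = q i) ->
     ren_formula r' (ren_formula r A) = ren_formula q A).
Proof.
  assert (Hup : forall r r' q, (forall i, r' (r i) = q i) ->
    forall i, up_ren r' (up_ren r i) = up_ren q i).
  { intros r r' q H [|i]; cbn; auto. }
  apply term_formula_ind; cbn; intros; auto; f_equal; auto.
Qed.

Lemma subst_ren_expr :
  (forall t r s q, (forall i, s (r i) = q i) ->
     subst_term s (ren_term r t) = subst_term q t) /\
  (forall A r s q, (forall i, s (r i) = q i) ->
     subst_formula s (ren_formula r A) = subst_formula q A).
Proof.
  assert (Hup : forall r s q, (forall i, s (r i) = q i) ->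
    forall i, up s (up_ren r i) = up q i).
  { intros r s q H [|i]; cbn; f_equal; auto. }
  apply term_formula_ind; cbn; intros; auto; f_equal; auto.
Qed.

Lemma ren_subst_expr :
  (forall t r s q, (forall i, ren_term r (s i) = q i) ->
     ren_term r (subst_term s t) = subst_term q t) /\
  (forall A r s q, (forall i, ren_term r (s i) = q i) ->
     ren_formula r (subst_formula s A) = subst_formula q A).
Proof.
  assert (Hup : forall r s q, (forall i, ren_term r (s i) = q i) ->
    forall i, ren_term (up_ren r) (up s i) = up q i).
  { intros r s q H [|i]; cbn; auto.
    rewrite <- H; unfold shift.
    rewrite (proj1 ren_ren_expr) with (q := fun i => S (r i)) by auto.
    symmetry; apply ren_ren_expr; auto. }
  apply term_formula_ind; cbn; intros; auto; f_equal; auto.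
Qed.

Lemma subst_id_expr :
  (forall t s, (forall i, s i = TVar i) -> subst_term s t = t) /\
  (forall A s, (forall i, s i = TVar i) -> subst_formula s A = A).
Proof.
  assert (Hup : forall s, (forall i, s i = TVar i) -> forall i, up s i = TVar i).
  { intros s H [|i]; cbn; [|rewrite H]; reflexivity. }
  apply term_formula_ind; cbn; intros; auto; f_equal; auto.
Qed.

(** Names the substitution inlined in [inst], so that rewriting lemmas can refer to it. *)
Definition single (b : term) (i : nat) : term :=
  match i with 0 => b | S j => TVar j end.

Lemma subst_single_shift b t : subst_term (single b) (shift t) = t.
Proof.
  unfold shift; rewrite (proj1 subst_ren_expr) with (q := TVar) by auto.
  apply subst_id_expr; auto.
Qed.

Lemma subst_up_shift s t : subst_term (up s) (shift t) = shift (subst_term s t).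
Proof.
  unfold shift.
  rewrite (proj1 subst_ren_expr) with (q := fun i => ren_term S (s i)) by auto.
  symmetry; apply ren_subst_expr; auto.
Qed.

Lemma subst_FEq s a b :
  subst_formula s (FEq a b) = FEq (subst_term s a) (subst_term s b).
Proof. unfold FEq; cbn; rewrite !subst_up_shift; reflexivity. Qed.

Lemma subst_TPair s a b :
  subst_term s (TPair a b) = TPair (subst_term s a) (subst_term s b).
Proof.
  unfold TPair, FOr, FNeg; cbn [subst_term subst_formula].
  rewrite !subst_FEq, !subst_up_shift; reflexivity.
Qed.

Lemma subst_TOPair s a b :
  subst_term s (TOPair a b) = TOPair (subst_term s a) (subst_term s b).
Proof. unfold TOPair, TSing; rewrite !subst_TPair; reflexivity. Qed.

(** The set $\{w\mid\langle w,z\rangle\in z\}$ used inside the kernel; the manifestation set is its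
    value at the kernel itself. *)
Definition fiber (z : term) : term :=
  TAbs (FMem (TOPair (TVar 0) (shift z)) (shift z)).

Lemma subst_fiber s z : subst_term s (fiber z) = fiber (subst_term s z).
Proof.
  unfold fiber; cbn [subst_term subst_formula].
  rewrite subst_TOPair, subst_up_shift; reflexivity.
Qed.

Definition kernel_body : formula :=
  FEx (FEx (FAnd (FEq (TVar 2) (TOPair (TVar 1) (TVar 0)))
                 (FNotMem (TVar 1) (fiber (TVar 0))))).

Definition kernel : term := TAbs kernel_body.

Lemma ring_a_fiber : ring_a = fiber kernel.
Proof. reflexivity. Qed.

(** * Closed terms *)

Lemma below_ren_expr :
  (forall t n m r, (forall i, i < n -> r i < m) ->
     term_below n t -> term_below m (ren_term r t)) /\
  (forall A n m r, (forall i, i < n -> r i < m) ->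
     formula_below n A -> formula_below m (ren_formula r A)).
Proof.
  assert (Hup : forall n m r, (forall i, i < n -> r i < m) ->
    forall i, i < S n -> up_ren r i < S m).
  { intros n m r H [|i] Hi; cbn; [lia|].
    assert (r i < m) by (apply H; lia); lia. }
  apply term_formula_ind; cbn; intros; intuition eauto.
Qed.

Lemma below_shift n t : term_below n t -> term_below (S n) (shift t).
Proof. apply below_ren_expr; lia. Qed.

Lemma below_FEq n a b :
  term_below n a -> term_below n b -> formula_below n (FEq a b).
Proof.
  intros Ha%below_shift Hb%below_shift; cbn; intuition lia.
Qed.

Lemma below_TPair n a b :
  term_below n a -> term_below n b -> term_below n (TPair a b).
Proof.
  intros Ha%below_shift Hb%below_shift.
  assert (H0 : term_below (S n) (TVar 0)) by (cbn; lia).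
  pose proof (below_FEq _ _ _ H0 Ha); pose proof (below_FEq _ _ _ H0 Hb).
  unfold TPair, FOr, FNeg; cbn [term_below formula_below]; tauto.
Qed.

Lemma below_TOPair n a b :
  term_below n a -> term_below n b -> term_below n (TOPair a b).
Proof. intros; unfold TOPair, TSing; auto using below_TPair. Qed.

Lemma below_fiber n z : term_below n z -> term_below n (fiber z).
Proof.
  intros Hz%below_shift; split; [|exact Hz].
  apply below_TOPair; [cbn; lia | exact Hz].
Qed.

Lemma below_kernel : term_below 0 kernel.
Proof.
  assert (H : forall i, i < 3 -> term_below 3 (TVar i)) by (cbn; auto).
  assert (Hp : formula_below 3 (FEq (TVar 2) (TOPair (TVar 1) (TVar 0)))).
  { apply below_FEq; [|apply below_TOPair]; apply H; lia. }
  assert (Hf : formula_below 3 (FMem (TVar 1) (fiber (TVar 0)))).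
  { split; [|apply below_fiber]; apply H; lia. }
  unfold kernel, kernel_body, FEx, FAnd, FNotMem, FNeg.
  cbn [term_below formula_below] in *; tauto.
Qed.

Lemma below_ring_a : term_below 0 ring_a.
Proof. rewrite ring_a_fiber; apply below_fiber, below_kernel. Qed.

Lemma subst_below_expr :
  (forall t n s, (forall i, i < n -> s i = TVar i) ->
     term_below n t -> subst_term s t = t) /\
  (forall A n s, (forall i, i < n -> s i = TVar i) ->
     formula_below n A -> subst_formula s A = A).
Proof.
  assert (Hup : forall n s, (forall i, i < n -> s i = TVar i) ->
    forall i, i < S n -> up s i = TVar i).
  { intros n s H [|i] Hi; cbn; [|rewrite H by lia]; reflexivity. }
  apply term_formula_ind; cbn; intros; auto; f_equal; intuition eauto.
Qed.

Lemma subst_closed s t : term_below 0 t -> subst_term s t = t.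
Proof. apply subst_below_expr; lia. Qed.

Lemma shift_closed t : term_below 0 t -> shift t = t.
Proof.
  (* The renaming is absorbed into a substitution, to which [subst_closed] applies; [TF] is an
     arbitrary choice. *)
  intros Ht; rewrite <- (subst_closed (single TF) t Ht) at 1.
  rewrite <- subst_up_shift; unfold shift.
  erewrite (proj1 subst_ren_expr) by reflexivity.
  apply subst_closed, Ht.
Qed.

(** * Ordinals *)

Definition osucc (x : ord) : ord := osup unit (fun _ => x).

Lemma ole_refl x : ole x x.
Proof. induction x as [I f IH]; cbn; eauto. Qed.

Lemma ole_trans x y z : ole x y -> ole y z -> ole x z.
Proof.
  revert y z; induction x as [I f IH]; intros [J g] [K h] Hxy Hyz i.
  destruct (Hxy i) as [j Hj]; destruct (Hyz j) as [k Hk].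
  exists k; eauto.
Qed.

Lemma olt_ole x y : olt x y -> ole x y.
Proof.
  revert y; induction x as [I f IH]; intros [J g] [j Hj] i.
  exists j; apply IH; destruct (g j) as [K h]; apply Hj.
Qed.

Lemma ole_osupE I (f : I -> ord) y : ole (osup I f) y <-> forall i, olt (f i) y.
Proof. destruct y; reflexivity. Qed.

Lemma ole_olt_trans x y z : ole x y -> olt y z -> olt x z.
Proof. destruct z; intros H [k Hk]; exists k; eapply ole_trans; eauto. Qed.

Lemma olt_ole_trans x y z : olt x y -> ole y z -> olt x z.
Proof.
  destruct y as [J g]; intros [j Hj] H; rewrite ole_osupE in H.
  eapply ole_olt_trans; eauto.
Qed.

Lemma olt_wf : well_founded olt.
Proof.
  (* Generalized to all $y\le x$, since an ordinal below [osup I f] is only known to be at most some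
     [f i]. *)
  enough (H : forall x y, ole y x -> Acc olt y) by (intro x; eapply H, ole_refl).
  induction x as [I f IH]; intros y Hy; constructor; intros z Hz.
  destruct (olt_ole_trans _ _ _ Hz Hy) as [i Hi]; eauto.
Qed.

Lemma olt_irrefl x : ~ olt x x.
Proof.
  induction x as [x IH] using (well_founded_ind olt_wf); intros H.
  exact (IH x H H).
Qed.

Lemma ole_or_olt x y : ole x y \/ olt y x.
Proof.
  revert y; induction x as [I f IH]; intros y.
  rewrite ole_osupE.
  destruct (classic (forall i, olt (f i) y)) as [H|H]; [auto|right].
  apply not_all_ex_not in H as [i Hi]; exists i.
  destruct y as [J g]; apply ole_osupE; intro j.
  destruct (IH i (g j)) as [Hle|]; [|assumption].
  contradict Hi; exists j; exact Hle.
Qed.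

Lemma olt_osuccE x y : olt x (osucc y) <-> ole x y.
Proof. cbn; split; [intros [_ H]; exact H | exists tt; assumption]. Qed.

Lemma olt_osucc x : olt x (osucc x).
Proof. apply olt_osuccE, ole_refl. Qed.

Lemma ole_osucc x : ole x (osucc x).
Proof. apply olt_ole, olt_osucc. Qed.

Lemma ole_osuccE x y : ole (osucc x) y <-> olt x y.
Proof.
  unfold osucc; rewrite ole_osupE; split; [intro H; exact (H tt) | auto].
Qed.

Lemma olt_osup I (f : I -> ord) i : olt (f i) (osup I f).
Proof. exists i; apply ole_refl. Qed.

Lemma olt_ozero_osucc x : olt ozero (osucc x).
Proof. apply olt_osuccE; destruct x; intros []. Qed.

(** The last clause keeps [z] below every ordinal that is above both [x] and [y]. *)
Lemma omax_exists x y : exists z, ole x z /\ ole y z /\ (z = x \/ z = y).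
Proof.
  destruct (ole_or_olt x y) as [H|H%olt_ole]; [exists y|exists x];
    auto using ole_refl.
Qed.

(** Zero qualifies, so positivity is stated separately. *)
Definition olimit (x : ord) : Prop := forall y, olt y x -> olt (osucc y) x.

Lemma olimit_or_osucc x : olimit x \/ exists y, oeq x (osucc y).
Proof.
  destruct (classic (olimit x)) as [|H]; [auto|right].
  apply not_all_ex_not in H as [y H]; apply imply_to_and in H as [H1 H2].
  exists y; split; [|apply ole_osuccE, H1].
  destruct (ole_or_olt x (osucc y)); tauto.
Qed.

(** The limit taken is $x+\omega$. *)
Lemma olimit_above x : exists y, olt x y /\ olimit y.
Proof.
  pose (f k := Nat.iter k osucc x).
  exists (osup nat f); split; [exact (olt_osup nat f 0)|].
  intros y [k Hk]; apply ole_olt_trans with (f (S k)).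
  - apply ole_osuccE, olt_osuccE, Hk.
  - apply olt_osup.
Qed.

Section Semantics.

Variable M : ord -> nat -> formula -> Prop.
Hypothesis hM : librationist_semantics M.

(** * Connectives and membership *)

Lemma sem_nor alpha n A B :
  M alpha n (FNor A B) <-> ~ M alpha n A /\ ~ M alpha n B.
Proof. apply (sem_full M hM). Qed.

Lemma sem_all alpha n A :
  M alpha n (FAll A) <-> forall b, M alpha n (inst A b).
Proof. apply (sem_full M hM). Qed.

Lemma sem_neg alpha n A : M alpha n (FNeg A) <-> ~ M alpha n A.
Proof. unfold FNeg; rewrite sem_nor; tauto. Qed.

Lemma sem_or alpha n A B :
  M alpha n (FOr A B) <-> M alpha n A \/ M alpha n B.
Proof.
  unfold FOr; rewrite sem_neg, sem_nor.
  destruct (classic (M alpha n A)), (classic (M alpha n B)); tauto.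
Qed.

Lemma sem_and alpha n A B :
  M alpha n (FAnd A B) <-> M alpha n A /\ M alpha n B.
Proof.
  unfold FAnd; rewrite sem_nor, !sem_neg.
  destruct (classic (M alpha n A)), (classic (M alpha n B)); tauto.
Qed.

Lemma sem_imp alpha n A B :
  M alpha n (FImp A B) <-> (M alpha n A -> M alpha n B).
Proof.
  unfold FImp; rewrite sem_or, sem_neg.
  destruct (classic (M alpha n A)); tauto.
Qed.

Lemma sem_ex alpha n A :
  M alpha n (FEx A) <-> exists b, M alpha n (inst A b).
Proof.
  unfold FEx; rewrite sem_neg, sem_all; split.
  - intros H; apply not_all_ex_not in H as [b H]; exists b.
    change (~ M alpha n (FNeg (inst A b))) in H; rewrite sem_neg in H; tauto.
  - intros [b Hb] H; specialize (H b).
    change (M alpha n (FNeg (inst A b))) in H; rewrite sem_neg in H; tauto.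
Qed.

Lemma sem_eq alpha n s t :
  M alpha n (FEq s t) <->
  forall u, M alpha n (FMem s u) -> M alpha n (FMem t u).
Proof.
  unfold FEq; rewrite sem_all.
  assert (E : forall u, inst (FImp (FMem (shift s) (TVar 0))
                                   (FMem (shift t) (TVar 0))) u
                        = FImp (FMem s u) (FMem t u)).
  { intro u; unfold inst; fold (single u); cbn.
    rewrite !subst_single_shift; reflexivity. }
  split; intros H u; specialize (H u); rewrite E, sem_imp in *; exact H.
Qed.

Lemma sem_eq_refl alpha n s : M alpha n (FEq s s).
Proof. apply sem_eq; auto. Qed.

(** Every final segment below a successor contains the last stage, and the one starting there
    contains nothing else up to [oeq]. *)
Lemma sem_truth_osucc alpha n A : M (osucc alpha) n (FTrue A) <-> M alpha n A.
Proof.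
  rewrite (sem_truth M hM) by apply olt_ozero_osucc; split.
  - intros (g & Hg & H); apply H; [apply olt_osuccE, Hg | apply olt_osucc].
  - intros H; exists alpha; split; [apply olt_osucc|].
    intros d H1 H2; apply olt_osuccE in H2.
    apply (sem_oeq M hM) with alpha; [split|]; assumption.
Qed.

Lemma sem_mem_osucc alpha n a A :
  M (osucc alpha) n (FMem a (TAbs A)) <-> M alpha n (inst A a).
Proof.
  rewrite (sem_abs M hM) by apply olt_ozero_osucc; apply sem_truth_osucc.
Qed.

Lemma sem_truth_everywhere alpha n A :
  olt ozero alpha -> (forall beta, M beta n A) -> M alpha n (FTrue A).
Proof. intros Ha H; apply (sem_truth M hM); [assumption|exists ozero; auto]. Qed.

(** * Identity *)

(* The witness is [u = {x | s = x}], to which [s] always belongs. *)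
Lemma sem_eq_truth alpha n s t :
  olt ozero alpha -> M alpha n (FEq s t) -> M alpha n (FTrue (FEq s t)).
Proof.
  intros Ha H; rewrite sem_eq in H.
  specialize (H (TAbs (FEq (shift s) (TVar 0)))).
  rewrite !(sem_abs M hM) in H by assumption.
  unfold inst in H; fold (single s) (single t) in H.
  rewrite !subst_FEq, !subst_single_shift in H; cbn in H.
  apply H, sem_truth_everywhere; auto using sem_eq_refl.
Qed.

(** Identity at $\alpha$ is true there by [sem_eq_truth], so it holds on some segment $[g,\alpha)$.
    Stages before $g$ are reached by induction, applied to $g<\alpha$. *)
Lemma sem_eq_downward alpha beta n s t :
  ole beta alpha -> M alpha n (FEq s t) -> M beta n (FEq s t).
Proof.
  revert beta; induction alpha as [alpha IH] using (well_founded_ind olt_wf).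
  intros beta Hba H.
  destruct (ole_or_olt alpha beta) as [Hab|Hlt].
  { apply (sem_oeq M hM) with alpha; [split|]; assumption. }
  apply sem_eq_truth in H.
  2: { eapply ole_olt_trans; [|exact Hlt]; destruct beta; intros []. }
  apply (sem_truth M hM) in H as (g & Hg & H).
  2: { eapply ole_olt_trans; [|exact Hlt]; destruct beta; intros []. }
  destruct (ole_or_olt g beta) as [Hgb|Hbg]; [auto|].
  apply (IH g); auto using olt_ole, ole_refl.
Qed.

Definition perm_eq n s t : Prop := forall beta, M beta n (FEq s t).

Definition settled (kappa : ord) : Prop :=
  forall n s t delta, ole kappa delta -> M delta n (FEq s t) -> perm_eq n s t.

(** For each index and pair of terms whose identity is not permanent, choose a stage where it fails;
    by downward persistence it fails from there on. [kappa] is the strict supremum of the chosen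
    stages. *)
Lemma settled_exists : exists kappa, settled kappa.
Proof.
  assert (H : forall p : nat * term * term, exists k,
    let '(n, s, t) := p in M k n (FEq s t) -> perm_eq n s t).
  { intros [[n s] t].
    destruct (classic (perm_eq n s t)) as [Hp|Hp]; [exists ozero; auto|].
    apply not_all_ex_not in Hp as [k Hk]; exists k; tauto. }
  pose (f p := proj1_sig (constructive_indefinite_description _ (H p))).
  exists (osup _ f); intros n s t d Hd E.
  assert (Hf := proj2_sig (constructive_indefinite_description _ (H (n, s, t)))).
  apply Hf; fold (f (n, s, t)).
  apply sem_eq_downward with d; [|assumption].
  eapply ole_trans; [|exact Hd]; apply olt_ole, olt_osup.
Qed.

(** Leibniz identity is applied to the set [TAbs A] one stage later, where membership means the
    instance of [A] at [beta]. *)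
Lemma perm_eq_inst n s t A beta :
  perm_eq n s t -> M beta n (inst A s) -> M beta n (inst A t).
Proof.
  intros H HA; specialize (H (osucc beta)); rewrite sem_eq in H.
  apply sem_mem_osucc, H, sem_mem_osucc, HA.
Qed.

Lemma perm_eq_sym n s t : perm_eq n s t -> perm_eq n t s.
Proof.
  intros H beta.
  assert (E : forall x, inst (FEq (TVar 0) (shift s)) x = FEq x s).
  { intro x; unfold inst; fold (single x).
    rewrite subst_FEq, subst_single_shift; reflexivity. }
  rewrite <- E; apply perm_eq_inst with s; [assumption|].
  rewrite E; apply sem_eq_refl.
Qed.

Lemma perm_eq_trans n s t u : perm_eq n s t -> perm_eq n t u -> perm_eq n s u.
Proof.
  intros H1 H2 beta; apply sem_eq; intros w Hw.
  specialize (H1 beta); specialize (H2 beta); rewrite sem_eq in H1, H2; auto.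
Qed.

Lemma perm_eq_mem_right n s t x beta :
  perm_eq n s t -> M beta n (FMem x s) -> M beta n (FMem x t).
Proof.
  assert (E : forall y, inst (FMem (shift x) (TVar 0)) y = FMem x y).
  { intro y; unfold inst; fold (single y); cbn.
    rewrite subst_single_shift; reflexivity. }
  intros H; rewrite <- !E; apply perm_eq_inst, H.
Qed.

Lemma perm_eq_fiber n v y a z beta :
  perm_eq n v y -> perm_eq n a z ->
  M beta n (FMem v (fiber a)) -> M beta n (FMem y (fiber z)).
Proof.
  intros Hv Ha H; specialize (Hv beta); rewrite sem_eq in Hv; apply Hv in H.
  assert (E : forall x, inst (FMem (shift y) (fiber (TVar 0))) x
                        = FMem y (fiber x)).
  { intro x; unfold inst; fold (single x); cbn [subst_formula].
    rewrite subst_single_shift, subst_fiber; reflexivity. }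
  rewrite <- E in *; eapply perm_eq_inst; eassumption.
Qed.

(** * Ordered pairs and the manifestation kernel *)

Lemma sem_mem_pair_osucc alpha n s p q :
  M (osucc alpha) n (FMem s (TPair p q)) <->
  M alpha n (FEq s p) \/ M alpha n (FEq s q).
Proof.
  unfold TPair; rewrite sem_mem_osucc.
  unfold inst, FOr, FNeg; fold (single s); cbn [subst_formula].
  rewrite !subst_FEq, !subst_single_shift.
  apply sem_or.
Qed.

Lemma sem_kernel_body alpha n p :
  M alpha n (inst kernel_body p) <->
  exists y z, M alpha n (FEq p (TOPair y z)) /\ ~ M alpha n (FMem y (fiber z)).
Proof.
  (* The three equations instantiate $u$, $y$ and $z$ in turn; the shifts count the binders still
     open. *)
  assert (E1 : inst kernel_body p =
    FEx (FEx (FAnd (FEq (shift (shift p)) (TOPair (TVar 1) (TVar 0)))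
                   (FNotMem (TVar 1) (fiber (TVar 0)))))).
  { unfold inst; fold (single p).
    unfold kernel_body, FEx, FAnd, FNotMem, FNeg; cbn [subst_formula].
    rewrite !subst_FEq, !subst_TOPair, !subst_fiber; reflexivity. }
  assert (E2 : forall y,
    inst (FEx (FAnd (FEq (shift (shift p)) (TOPair (TVar 1) (TVar 0)))
                    (FNotMem (TVar 1) (fiber (TVar 0))))) y =
    FEx (FAnd (FEq (shift p) (TOPair (shift y) (TVar 0)))
              (FNotMem (shift y) (fiber (TVar 0))))).
  { intro y; unfold inst; fold (single y).
    unfold FEx, FAnd, FNotMem, FNeg; cbn [subst_formula].
    rewrite !subst_FEq, !subst_TOPair, !subst_fiber, !subst_up_shift,
      !subst_single_shift; reflexivity. }
  assert (E3 : forall y z,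
    inst (FAnd (FEq (shift p) (TOPair (shift y) (TVar 0)))
               (FNotMem (shift y) (fiber (TVar 0)))) z =
    FAnd (FEq p (TOPair y z)) (FNotMem y (fiber z))).
  { intros y z; unfold inst; fold (single z).
    unfold FAnd, FNotMem, FNeg; cbn [subst_formula].
    rewrite !subst_FEq, !subst_TOPair, !subst_fiber, !subst_single_shift;
      reflexivity. }
  rewrite E1, sem_ex; split.
  - intros [y H]; rewrite E2, sem_ex in H; destruct H as [z H].
    rewrite E3, sem_and in H; unfold FNotMem in H; rewrite sem_neg in H; eauto.
  - intros (y & z & H); exists y; rewrite E2, sem_ex; exists z.
    rewrite E3, sem_and; unfold FNotMem; rewrite sem_neg; exact H.
Qed.

(** * The manifestation set at successor stages *)

Definition in_ring (alpha : ord) (n : nat) (v : term) : Prop :=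
  M alpha n (FMem v (fiber kernel)).

Definition in_kernel (alpha : ord) (n : nat) (v : term) : Prop :=
  M alpha n (FMem (TOPair v kernel) kernel).

Definition ring_witness (v : term) : formula :=
  inst kernel_body (TOPair v kernel).

Lemma inst_fiber_kernel v :
  inst (FMem (TOPair (TVar 0) kernel) kernel) v = FMem (TOPair v kernel) kernel.
Proof.
  unfold inst; fold (single v); cbn [subst_formula].
  rewrite subst_TOPair, (subst_closed _ kernel) by exact below_kernel; reflexivity.
Qed.

Lemma in_ring_truth alpha n v :
  olt ozero alpha ->
  in_ring alpha n v <-> M alpha n (FTrue (FMem (TOPair v kernel) kernel)).
Proof.
  intros Ha; unfold in_ring, fiber.
  rewrite (sem_abs M hM) by exact Ha.
  rewrite shift_closed, inst_fiber_kernel by exact below_kernel; reflexivity.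
Qed.

Lemma in_ring_osucc alpha n v :
  in_ring (osucc alpha) n v <-> in_kernel alpha n v.
Proof. rewrite in_ring_truth by apply olt_ozero_osucc; apply sem_truth_osucc. Qed.

Lemma in_kernel_osucc alpha n v :
  in_kernel (osucc alpha) n v <-> M alpha n (ring_witness v).
Proof. apply sem_mem_osucc. Qed.

(** Two stages are spent on two abstractions: the manifestation set, then the kernel. *)
Lemma in_ring_osucc2 alpha n v :
  in_ring (osucc (osucc alpha)) n v <-> M alpha n (ring_witness v).
Proof. rewrite in_ring_osucc; apply in_kernel_osucc. Qed.

(** The pair witnesses itself by reflexivity, so this direction holds at every stage; the converse
    will use injectivity of pairs beyond [kappa]. *)
Lemma ring_witness_of_notin alpha n v :
  ~ in_ring alpha n v -> M alpha n (ring_witness v).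
Proof.
  intros H; apply sem_kernel_body; exists v, kernel; split; [|exact H].
  apply sem_eq_refl.
Qed.

(** * The oscillation sentence *)

Definition all_in : formula := FAll (FMem (TVar 0) ring_a).
Definition none_in : formula := FAll (FNotMem (TVar 0) ring_a).

(** At $\alpha+2$, [FTrue (FTrue all_in)] says that [all_in] held at $\alpha$. The last conjunct
    thus excludes a manifestation set that is full at both stages. *)
Definition oscillation : formula :=
  FOr none_in (FAnd all_in (FNeg (FTrue (FTrue all_in)))).

Lemma sentence_oscillation : sentence oscillation.
Proof.
  assert (H1 : term_below 1 ring_a).
  { rewrite <- shift_closed by exact below_ring_a.
    apply below_shift, below_ring_a. }
  cbn -[ring_a]; intuition lia.
Qed.

Lemma inst_mem_ring_a v : inst (FMem (TVar 0) ring_a) v = FMem v (fiber kernel).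
Proof.
  unfold inst; fold (single v); cbn [subst_formula].
  rewrite (subst_closed _ ring_a) by exact below_ring_a.
  rewrite ring_a_fiber; reflexivity.
Qed.

Lemma sem_all_in alpha n : M alpha n all_in <-> forall v, in_ring alpha n v.
Proof.
  unfold all_in; rewrite sem_all; split; intros H v; specialize (H v);
    rewrite inst_mem_ring_a in *; exact H.
Qed.

Lemma sem_none_in alpha n : M alpha n none_in <-> forall v, ~ in_ring alpha n v.
Proof.
  unfold none_in; rewrite sem_all; split; intros H v; specialize (H v).
  - change (M alpha n (FNeg (inst (FMem (TVar 0) ring_a) v))) in H.
    rewrite sem_neg, inst_mem_ring_a in H; exact H.
  - change (M alpha n (FNeg (inst (FMem (TVar 0) ring_a) v))).
    rewrite sem_neg, inst_mem_ring_a; exact H.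
Qed.

Lemma sem_oscillation alpha n :
  M alpha n oscillation <->
  M alpha n none_in \/
  M alpha n all_in /\ ~ M alpha n (FTrue (FTrue all_in)).
Proof. unfold oscillation; rewrite sem_or, sem_and, sem_neg; tauto. Qed.

Lemma none_in_all_in alpha n :
  M alpha n none_in -> M (osucc (osucc alpha)) n all_in.
Proof.
  rewrite sem_none_in, sem_all_in; intros H v.
  apply in_ring_osucc2, ring_witness_of_notin, H.
Qed.

(** * Stages beyond the settling of identity *)

Section Settled.

Variable kappa : ord.
Hypothesis hkappa : settled kappa.

(** Membership at [osucc kappa] evaluates identity at [kappa], where it is already permanent. *)
Lemma settled_mem_pair n s p q :
  M (osucc kappa) n (FMem s (TPair p q)) <-> perm_eq n s p \/ perm_eq n s q.
Proof.
  rewrite sem_mem_pair_osucc; split.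
  - intros [H|H]; [left|right]; eapply hkappa; eauto using ole_refl.
  - intros [H|H]; [left|right]; apply H.
Qed.

Lemma settled_pair_sub n a b c d x :
  perm_eq n (TPair a b) (TPair c d) -> perm_eq n x a \/ perm_eq n x b ->
  perm_eq n x c \/ perm_eq n x d.
Proof.
  rewrite <- !settled_mem_pair; intros H; apply perm_eq_mem_right, H.
Qed.

Lemma settled_opair_inj n v a y z :
  perm_eq n (TOPair v a) (TOPair y z) -> perm_eq n v y /\ perm_eq n a z.
Proof.
  intros H; unfold TOPair, TSing in H.
  assert (R : forall x, perm_eq n x x) by (intros x b; apply sem_eq_refl).
  pose proof (perm_eq_sym _ _ _ H) as H'.
  assert (Hy : perm_eq n v y).
  (* $\{v\}$ is $\{y\}$ or $\{y,z\}$, and $y$ belongs to either. *)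
  { destruct (settled_pair_sub _ _ _ _ _ _ H (or_introl (R _)))
      as [E%perm_eq_sym|E%perm_eq_sym];
      destruct (settled_pair_sub _ _ _ _ _ y E (or_introl (R _)));
      apply perm_eq_sym; assumption. }
  split; [exact Hy|].
  assert (Ha : perm_eq n a y \/ perm_eq n a z).
  { destruct (settled_pair_sub _ _ _ _ _ _ H (or_intror (R _))) as [E|E];
      destruct (settled_pair_sub _ _ _ _ _ a E (or_intror (R _))); auto. }
  assert (Hz : perm_eq n z v \/ perm_eq n z a).
  { destruct (settled_pair_sub _ _ _ _ _ _ H' (or_intror (R _))) as [E|E];
      destruct (settled_pair_sub _ _ _ _ _ z E (or_intror (R _))); auto. }
  (* If $a=y$ and $z=v$, then $a=y=v=z$. *)
  destruct Ha as [Ha|Ha]; [|assumption].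
  destruct Hz as [Hz|Hz]; apply perm_eq_sym in Hz; [|assumption].
  eauto using perm_eq_trans, perm_eq_sym.
Qed.

Lemma settled_ring_witness delta n v :
  ole kappa delta -> M delta n (ring_witness v) <-> ~ in_ring delta n v.
Proof.
  intros Hd; split; [|apply ring_witness_of_notin].
  intros (y & z & E & Hyz)%sem_kernel_body Hv; apply Hyz.
  apply hkappa, settled_opair_inj in E as [E1 E2]; [|assumption].
  exact (perm_eq_fiber _ _ _ _ _ _ E1 E2 Hv).
Qed.

Lemma settled_in_ring_osucc2 delta n v :
  ole kappa delta ->
  in_ring (osucc (osucc delta)) n v <-> ~ in_ring delta n v.
Proof. intros; rewrite in_ring_osucc2; apply settled_ring_witness; assumption. Qed.

(** Membership at a limit would put $\langle v,\mathbf a\rangle$ in $\mathbf a$ on a final segment.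
    At $d+1$ this puts $v$ in the manifestation set at $d+2$; at $d+3$ it excludes $v$ at $d+2$. *)
Lemma settled_none_in_limit beta n :
  olt kappa beta -> olt ozero beta -> olimit beta -> M beta n none_in.
Proof.
  intros Hk H0 Hl; apply sem_none_in; intros v Hv.
  apply in_ring_truth, (sem_truth M hM) in Hv as (g & Hg & H); auto.
  destruct (omax_exists kappa g) as (d & Hkd & Hgd & Hd).
  assert (Hdb : olt d beta) by (destruct Hd; subst d; assumption).
  assert (K1 : in_kernel (osucc d) n v).
  { apply H; [|apply Hl, Hdb].
    eapply ole_trans; [exact Hgd|apply ole_osucc]. }
  assert (K2 : in_kernel (osucc (osucc (osucc d))) n v).
  { apply H; [|apply Hl, Hl, Hl, Hdb].
    eapply ole_trans; [exact Hgd|].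
    eauto using ole_trans, ole_osucc. }
  apply in_kernel_osucc in K2; apply settled_ring_witness in K2;
    [|eauto using ole_trans, ole_osucc].
  apply K2, in_ring_osucc, K1.
Qed.

(** Here the kernel condition itself would hold on a final segment below the limit. At $d$ it puts
    $v$ in the manifestation set at $d+2$; at $d+2$ it excludes $v$ there. *)
Lemma settled_none_in_osucc_limit beta n :
  olt kappa beta -> olt ozero beta -> olimit beta ->
  M (osucc beta) n none_in.
Proof.
  intros Hk H0 Hl; apply sem_none_in; intros v Hv.
  apply in_ring_osucc, (sem_abs M hM), (sem_truth M hM) in Hv
    as (g & Hg & H); auto.
  destruct (omax_exists kappa g) as (d & Hkd & Hgd & Hd).
  assert (Hdb : olt d beta) by (destruct Hd; subst d; assumption).
  pose proof (H d Hgd Hdb) as W1.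
  assert (W2 : M (osucc (osucc d)) n (ring_witness v)).
  { apply H; [|apply Hl, Hl, Hdb]; eauto using ole_trans, ole_osucc. }
  apply settled_ring_witness in W2; [|eauto using ole_trans, ole_osucc].
  apply W2, in_ring_osucc2, W1.
Qed.

(** Induction in steps of two: a stage is a limit, the successor of a limit, or $d+2$ with
    $d\ge\lambda$, where the phase at $d$ is reversed. *)
Lemma settled_oscillation lambda beta n :
  olt kappa lambda -> olimit lambda -> ole lambda beta ->
  M beta n oscillation.
Proof.
  intros Hkl Hlim.
  assert (H0 : olt ozero lambda).
  { eapply ole_olt_trans; [|exact Hkl]; destruct kappa; intros []. }
  (* As $\lambda$ is a limit, taking predecessors never leads below it. *)
  assert (below : forall x, ole lambda (osucc x) -> ole lambda x).
  { intros x Hx; destruct (ole_or_olt lambda x) as [|Hlt]; [assumption|].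
    exfalso; apply (olt_irrefl (osucc x)).
    eapply olt_ole_trans; [apply Hlim, Hlt | exact Hx]. }
  induction beta as [beta IH] using (well_founded_ind olt_wf); intros Hb.
  destruct (olimit_or_osucc beta) as [Lb|[g Eg]].
  { apply sem_oscillation; left; apply settled_none_in_limit;
      eauto using olt_ole_trans. }
  apply (sem_oeq M hM) with (osucc g); [destruct Eg; split; assumption|].
  assert (Hg : ole lambda g).
  { apply below; eapply ole_trans; [exact Hb|apply Eg]. }
  destruct (olimit_or_osucc g) as [Lg|[d Ed]].
  { apply sem_oscillation; left; apply settled_none_in_osucc_limit;
      eauto using olt_ole_trans. }
  assert (Hd : ole lambda d).
  { apply below; eapply ole_trans; [exact Hg|apply Ed]. }
  assert (Eb : oeq (osucc (osucc d)) (osucc g)).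
  { destruct Ed; split; apply ole_osuccE, olt_osuccE; assumption. }
  apply (sem_oeq M hM) with (osucc (osucc d)); [exact Eb|].
  assert (Hdb : olt d beta).
  { eapply olt_ole_trans; [|apply Eg].
    eapply olt_ole_trans; [|apply Eb].
    apply olt_osuccE, ole_osucc. }
  assert (Hkd : ole kappa d) by (eapply ole_trans; [apply olt_ole|]; eassumption).
  specialize (IH d Hdb Hd); apply sem_oscillation in IH; apply sem_oscillation.
  rewrite !sem_truth_osucc.
  destruct IH as [IH|[IH _]].
  - right; split; [apply none_in_all_in, IH|].
    rewrite sem_none_in in IH; rewrite sem_all_in; intros H.
    (* Full and empty are incompatible as soon as one term exists; [TF] serves. *)
    exact (IH TF (H TF)).
  - left; rewrite sem_none_in; rewrite sem_all_in in IH.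
    intros v Hv; apply settled_in_ring_osucc2 in Hv; auto.
Qed.

End Settled.

Lemma IN_oscillation : IN M oscillation.
Proof.
  destruct settled_exists as [kappa hk].
  destruct (olimit_above kappa) as (l & Hl & Ll).
  exists (osucc l); intros b Hb n; apply ole_osuccE in Hb.
  apply (sem_truth M hM).
  - eapply ole_olt_trans; [|exact Hb]; destruct l; intros [].
  - exists l; split; [assumption|]; intros d Hd _.
    eapply settled_oscillation; eassumption.
Qed.

(** * The closure ordinal *)

Lemma IN_truth A : IN M (FTrue A) <-> IN M A.
Proof.
  split; intros [a H].
  - exists a; intros b Hb n; apply sem_truth_osucc, H.
    eapply ole_trans; [exact Hb|apply ole_osucc].
  - exists (osucc a); intros b Hb n; apply ole_osuccE in Hb.
    apply (sem_truth M hM).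
    + eapply ole_olt_trans; [|exact Hb]; destruct a; intros [].
    + exists a; split; [assumption|]; intros d Hd _; apply H, Hd.
Qed.

(** Stabilization at $\alpha+1$ is applied to $\mathcal TA$ as well as $A$: $\mathcal T\mathcal TA$
    at $\alpha+1$ is $\mathcal TA$ at $\alpha$, and $\mathrm{IN}(\mathcal TA)$ is equivalent to
    $\mathrm{IN}(A)$. *)
Lemma stabilizes_all_pred alpha :
  stabilizes_all M (osucc alpha) -> stabilizes_all M alpha.
Proof.
  intros H A HA.
  assert (HTA : sentence (FTrue A)) by (split; [exact HA|exact I]).
  destruct (H _ HA) as [H1 _]; destruct (H _ HTA) as [H2 H3].
  split.
  - intros HI b Hb n.
    destruct (ole_or_olt b alpha) as [Hba|Hlt].
    + apply (sem_oeq M hM) with alpha; [split; assumption|].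
      apply sem_truth_osucc, (H2 (proj2 (IN_truth A) HI)), ole_refl.
    + apply (H1 HI), ole_osuccE, Hlt.
  - intros Hm; apply IN_truth, H3; intros n; apply sem_truth_osucc, Hm.
Qed.

Lemma stabilizes_all_oeq alpha beta :
  oeq alpha beta -> stabilizes_all M alpha -> stabilizes_all M beta.
Proof.
  intros E H A HA; destruct (H A HA) as [H1 H2]; split.
  - intros HI b Hb; apply (H1 HI); eapply ole_trans; [apply E|exact Hb].
  - intros Hm; apply H2; intros n; apply (sem_oeq M hM) with beta.
    + destruct E; split; assumption.
    + apply Hm.
Qed.

Lemma closure_ordinal_olimit varpi : closure_ordinal M varpi -> olimit varpi.
Proof.
  intros [Hs Hmin].
  destruct (olimit_or_osucc varpi) as [|[g Eg]]; [assumption|exfalso].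
  apply (olt_irrefl g); apply olt_ole_trans with varpi.
  - apply ole_osuccE, Eg.
  - apply Hmin, stabilizes_all_pred, stabilizes_all_oeq with varpi; assumption.
Qed.

(** If $\mathcal T\neg A$ held at $\varpi$, then $\neg A$ would hold on a final segment below it,
    which meets the stages where $A$ holds. *)
Lemma thesis_of_cofinal varpi A :
  olt ozero varpi ->
  (forall n gamma, olt gamma varpi ->
     exists delta, ole gamma delta /\ olt delta varpi /\ M delta n A) ->
  thesis M varpi A.
Proof.
  intros H0 H n; apply sem_neg; intros HT.
  apply (sem_truth M hM) in HT as (g & Hg & HT); [|assumption].
  destruct (H n g Hg) as (d & Hgd & Hd & HA).
  specialize (HT d Hgd Hd); apply sem_neg in HT; contradiction.
Qed.

End Semantics.

(** * Cofinality of both phases below the closure ordinal *)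

Theorem theorem16p3p1 (M : ord -> nat -> formula -> Prop)
    (hM : librationist_semantics M)
    (varpi : ord) (hvarpi : closure_ordinal M varpi)
    (hpos : olt ozero varpi) :
  thesis M varpi (FAll (FMem (TVar 0) (shift ring_a))) /\
  thesis M varpi (FAll (FNotMem (TVar 0) (shift ring_a))).
Proof.
  rewrite (shift_closed _ below_ring_a); fold all_in none_in.
  pose proof (closure_ordinal_olimit M hM varpi hvarpi) as Hlim.
  (* Since $\varpi$ stabilizes [oscillation], its truth at $\varpi$ yields, for each index, a final
     segment on which it holds; [d] starts one beyond [g]. *)
  assert (Hosc : forall n g, olt g varpi -> exists d, ole g d /\ olt d varpi /\
    forall e, ole d e -> olt e varpi -> M e n oscillation).
  { intros n g Hg.
    destruct (proj1 hvarpi _ sentence_oscillation) as [HI _].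
    specialize (HI (IN_oscillation M hM) varpi (ole_refl _) n).
    apply (sem_truth M hM) in HI as (g' & Hg' & HI); [|assumption].
    destruct (omax_exists g g') as (d & H1 & H2 & H3).
    exists d; repeat split; eauto using ole_trans.
    destruct H3; subst; assumption. }
  split; apply thesis_of_cofinal; auto; intros n g Hg;
    destruct (Hosc n g Hg) as (d & Hgd & Hd & H);
    pose proof (H d (ole_refl _) Hd) as C; apply sem_oscillation in C; auto.
  - destruct C as [C|[C _]]; [|eauto].
    (* An empty stage [d] is followed two stages later by a full one, still below the limit
       $\varpi$. *)
    exists (osucc (osucc d)); repeat split.
    + eauto using ole_trans, ole_osucc.
    + apply Hlim, Hlim, Hd.
    + apply none_in_all_in; assumption.
  - destruct C as [C|[C _]]; [eauto|].
    assert (Hdd : ole d (osucc (osucc d))) by eauto using ole_trans, ole_osucc.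
    assert (Hddv : olt (osucc (osucc d)) varpi) by (apply Hlim, Hlim, Hd).
    exists (osucc (osucc d)); repeat split; eauto using ole_trans.
    pose proof (H _ Hdd Hddv) as C2; apply sem_oscillation in C2; auto.
    destruct C2 as [C2|[_ C2]]; [assumption|].
    (* Fullness at both $d$ and $d+2$ contradicts the last conjunct of [oscillation]. *)
    exfalso; apply C2, sem_truth_osucc, sem_truth_osucc; assumption.
Qed.
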